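(* Let $d\ge 3$ be a fixed integer and let $G\in\mathcal{G}(n,d)$ be a random $d$-regular graph on $n$ vertices (with $dn$ even). Then a.a.s. $G$ has linear tree-width and linear tree-depth; that is, there is a constant $\eta=\eta(d)>0$ such that $$\Pr\left(\operatorname{tw}(G)\ge \eta n \text{ and } \operatorname{td}(G)\ge\eta n\right)\to 1$$ as $n\to\infty$ along integers $n$ with $dn$ even. (The upper bounds $\operatorname{tw}(G)\le n$ and $\operatorname{td}(G)\le n$ always hold.)
   Context: $\mathcal{G}(n,d)$ is the configuration model of random $d$-regular graphs: to each of $n$ labeled vertices attach $d$ half-edges, choose a uniformly random perfect matching of the $dn$ half-edges, and let each matched pair form an edge between the corresponding vertices. The outcome may have loops and multiple edges; the tree-width and tree-depth are those of the underlying simple graph. A.a.s. (asymptotically almost surely) means with probability tending to $1$ as $n\to\infty$. $\operatorname{tw}(G)$ denotes the usual tree-width of $G$. Tree-depth: the closure of a rooted tree $T$ is the graph on the vertex set of $T$ in which two distinct vertices are adjacent iff one is an ancestor of the other in $T$. A rooted forest is a disjoint union of rooted trees, and its closure is the disjoint union of the closures of its trees. The height of a rooted tree is the maximum number of vertices on a path from the root to a vertex, and the height of a rooted forest is the maximum height of its trees. The tree-depth $\operatorname{td}(G)$ of a graph $G$ is the minimum height of a rooted forest $F$ on the vertex set $V(G)$ such that $G$ is a subgraph of the closure of $F$. (With this convention $\operatorname{td}(K_n)=n$.) *)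

(* Defs.v *)
From HB Require Import structures.
From mathcomp Require Import all_boot all_order all_algebra.
From mathcomp Require Import boolp reals.

Set Implicit Arguments.
Unset Strict Implicit.
Unset Printing Implicit Defensive.

Import Order.TTheory GRing.Theory Num.Theory.

Record sgraph (V : finType) := SGraph {
  adj :> rel V;
  adj_sym : symmetric adj;
  adj_irr : irreflexive adj }.

(* Cyclic sequences of pairwise distinct vertices of size at most 2 are not
   cycles of a simple graph: [:: x; y] just traverses an edge twice. *)
Definition acyclic (V : finType) (G : sgraph V) : Prop :=
  forall c : seq V, ucycle G c -> size c <= 2.

Definition is_tree (T : finType) (G : sgraph T) : Prop :=
  [/\ 0 < #|T|, forall x y, connect G x y & acyclic G].

Record tree_decomposition (V : finType) (G : sgraph V) (T : finType) :=
  TreeDecomposition {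
    dec_tree : sgraph T;
    bag : T -> {set V};
    dec_treeP : is_tree dec_tree;
    bag_vertex : forall v, exists t, v \in bag t;
    bag_edge : forall u v, G u v -> exists t, (u \in bag t) && (v \in bag t);
    bag_connected : forall v s t, v \in bag s -> v \in bag t ->
      connect [rel x y | [&& v \in bag x, v \in bag y & dec_tree x y]] s t }.

(* Predecessor is truncated: the graph without vertices has tree-width 0
   instead of -1. *)
Definition width (V : finType) (G : sgraph V) (T : finType)
    (D : tree_decomposition G T) : nat :=
  (\max_(t : T) #|bag D t|).-1.

Definition has_width (V : finType) (G : sgraph V) (k : nat) : Prop :=
  exists (T : finType) (D : tree_decomposition G T), width D = k.

Record rooted_forest (V : finType) := RootedForest {
  forest :> sgraph V;
  roots : {set V};
  forest_acyclic : acyclic forest;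
  forest_root : forall x, exists! r, r \in roots /\ connect forest r x }.

(* p is the sequence of all vertices, both ends included, of a path from a
   root to y. *)
Definition root_path (V : finType) (F : rooted_forest V) (y : V) (p : seq V) :=
  if p is r :: q then
    [&& r \in roots F, path F r q, uniq (r :: q) & last r q == y]
  else false.

Definition ancestor (V : finType) (F : rooted_forest V) (x y : V) : Prop :=
  exists2 p, root_path F y p & x \in p.

Definition closure_adj (V : finType) (F : rooted_forest V) (x y : V) : Prop :=
  x != y /\ (ancestor F x y \/ ancestor F y x).

(* A path has distinct vertices, so the bound on k loses nothing. *)
Definition height (V : finType) (F : rooted_forest V) : nat :=
  \max_(k < #|V|.+1 | `[< exists y p, root_path F y p /\ size p = k >]) k.

Definition has_forest_height (V : finType) (G : sgraph V) (h : nat) : Prop :=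
  exists F : rooted_forest V,
    (forall x y, G x y -> closure_adj F x y) /\ height F = h.

Section Existence.
Variable V : finType.

Lemma height_le (F : rooted_forest V) : height F <= #|V|.
Proof. by apply/bigmax_leqP => k _; rewrite -ltnS ltn_ord. Qed.

Let unit_adj : rel unit := fun _ _ => false.

Lemma unit_adj_sym : symmetric unit_adj. Proof. by []. Qed.
Lemma unit_adj_irr : irreflexive unit_adj. Proof. by []. Qed.

Lemma has_width_ex (G : sgraph V) : exists k, `[< has_width G k >].
Proof.
have tT : is_tree (SGraph unit_adj_sym unit_adj_irr).
  split; first by rewrite card_unit.
    by move=> [] []; exact: connect0.
  move=> c /andP[_ /card_uniqP <-].
  by apply: leq_trans (max_card _) _; rewrite card_unit.
have bv v : exists t : unit, v \in [set: V] by exists tt; rewrite inE.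
have be u v : G u v ->
    exists t : unit, (u \in [set: V]) && (v \in [set: V]).
  by exists tt; rewrite !inE.
unshelve eexists; last first.
  apply/asboolP; exists unit.
  unshelve eexists; last by [].
  apply: (@TreeDecomposition V G unit _ (fun=> [set: V]) tT bv be).
  by move=> v [] [] _ _; exact: connect0.
Qed.

Let line_adj : rel V := fun x y =>
  ((enum_rank x).+1 == enum_rank y :> nat) ||
  ((enum_rank y).+1 == enum_rank x :> nat).

Lemma line_adj_sym : symmetric line_adj.
Proof. by move=> x y; rewrite /line_adj orbC. Qed.

Lemma line_adj_irr : irreflexive line_adj.
Proof. by move=> x; rewrite /line_adj orbb; apply/negbTE; rewrite neq_ltn ltnSn orbT. Qed.

Let line := SGraph line_adj_sym line_adj_irr.

Lemma line_acyclic : acyclic line.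
Proof.
move=> c uc; rewrite leqNgt; apply/negP => c3.
have [x0 x0c] : exists x0, x0 \in c.
  by case: c c3 {uc} => // a c _; exists a; rewrite mem_head.
case: (@arg_maxnP V x0 (mem c) (fun x => enum_rank x : nat) x0c) => x xc xmax.
have [i s Es] := rot_to xc.
have : ucycle line (rot i c) by rewrite /ucycle rot_cycle rot_uniq.
have szs : size (rot i c) > 2 by rewrite size_rot.
have mem_c z : z \in rot i c -> enum_rank z <= enum_rank x.
  by rewrite mem_rot => /xmax.
rewrite Es in szs mem_c *.
case: s {Es} szs mem_c => [//|y s] szs mem_c.
case/lastP: s szs mem_c => [//|s z] _ mem_c.
rewrite /ucycle /= rcons_path !last_rcons => /andP[].
case/and3P=> xy _ zx.
case/and3P=> _ + _.
have yx1 : (enum_rank y).+1 = enum_rank x.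
  have := mem_c y; rewrite !inE eqxx orbT => /(_ isT) yx.
  by case/orP: xy => /eqP // E; rewrite -E ltnn in yx.
have zx1 : (enum_rank z).+1 = enum_rank x.
  have := mem_c z; rewrite !inE mem_rcons mem_head !orbT => /(_ isT) zx'.
  by case/orP: zx => /eqP // E; rewrite -E ltnn in zx'.
have -> : y = z.
  by apply/enum_rank_inj/val_inj/succn_inj; rewrite /= yx1 zx1.
by rewrite mem_rcons mem_head.
Qed.

Let line_roots : {set V} := [set x | enum_rank x == 0 :> nat].

Lemma line_path (n : nat) (y : V) : enum_rank y = n :> nat ->
  exists r q, [/\ r \in line_roots, path line r q, uniq (r :: q),
                 last r q = y &
                 forall x, (x \in r :: q) = (enum_rank x <= n)].
Proof.
elim: n y => [|n IH] y yn.
  exists y, [::]; split=> //; first by rewrite inE yn.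
  move=> x; rewrite inE leqn0 -yn; apply/eqP/eqP => [->//|/val_inj].
  exact: enum_rank_inj.
have nV : n < #|V| by apply: ltn_trans (ltn_ord (enum_rank y)); rewrite yn.
have [|r [q [r0 rq uq lq mq]]] := IH (enum_val (Ordinal nV)).
  by rewrite enum_valK.
exists r, (rcons q y); split => //.
- by rewrite rcons_path rq lq /= /line_adj enum_valK /= yn eqxx.
- by rewrite -rcons_cons rcons_uniq uq mq yn ltnn.
- by rewrite last_rcons.
- move=> x; rewrite -rcons_cons mem_rcons in_cons mq [RHS]leq_eqVlt ltnS.
  congr orb; apply/eqP/eqP => [->//|]; rewrite -yn => /val_inj.
  exact: enum_rank_inj.
Qed.

Lemma line_root x : exists! r, r \in line_roots /\ connect line r x.
Proof.
have [r [q [r0 rq _ lq _]]] := line_path (erefl (enum_rank x : nat)).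
exists r; split; first by split=> //; apply/connectP; exists q.
move=> r' [r'0 _]; apply/enum_rank_inj/val_inj => /=.
by move: r0 r'0; rewrite !inE => /eqP -> /eqP ->.
Qed.

Lemma has_forest_height_ex (G : sgraph V) :
  exists h, `[< has_forest_height G h >].
Proof.
pose F := RootedForest line_acyclic line_root.
exists (height F); apply/asboolP; exists F; split=> // x y Gxy.
have anc u v : enum_rank u <= enum_rank v -> ancestor F u v.
  have [r [q [r0 rq uq lq mq]]] := line_path (erefl (enum_rank v : nat)).
  move=> uv; exists (r :: q); last by rewrite mq.
  by apply/and4P; split=> //; apply/eqP.
split; first by apply: contraTneq Gxy => ->; rewrite adj_irr.
by case: (leqP (enum_rank x) (enum_rank y)) => [|/ltnW] /anc; [left|right].
Qed.

End Existence.

Definition treewidth (V : finType) (G : sgraph V) : nat :=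
  ex_minn (has_width_ex G).

Definition treedepth (V : finType) (G : sgraph V) : nat :=
  ex_minn (has_forest_height_ex G).

Lemma treewidth_le (V : finType) (G : sgraph V) : treewidth G <= #|V|.
Proof.
rewrite /treewidth; case: ex_minnP => k /asboolP[T [D <-]] _.
apply: leq_trans (leq_pred _) _.
by apply/bigmax_leqP => t _; exact: max_card.
Qed.

Lemma treedepth_le (V : finType) (G : sgraph V) : treedepth G <= #|V|.
Proof.
rewrite /treedepth; case: ex_minnP => h /asboolP[F [_ <-]] _.
exact: height_le.
Qed.

Definition perfect_matchings (H : finType) : {set {set {set H}}} :=
  [set M : {set {set H}} | partition M [set: H] &
    [forall B in M, #|B| == 2]].

(* (v, i) : 'I_n * 'I_d is the i-th half-edge at the vertex v. *)
Definition config_adj (n d : nat) (M : {set {set 'I_n * 'I_d}}) : rel 'I_n :=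
  fun u v => (u != v) &&
    [exists i : 'I_d, exists j : 'I_d, [set (u, i); (v, j)] \in M].

Lemma config_adj_sym n d (M : {set {set 'I_n * 'I_d}}) :
  symmetric (config_adj M).
Proof.
move=> u v; rewrite /config_adj eq_sym; congr andb.
by apply/existsP/existsP => -[i /existsP[j ijM]]; exists j;
  apply/existsP; exists i; rewrite setUC.
Qed.

Lemma config_adj_irr n d (M : {set {set 'I_n * 'I_d}}) :
  irreflexive (config_adj M).
Proof. by move=> u; rewrite /config_adj eqxx. Qed.

(* Loops and multiplicities are discarded: this is the simple graph underlying
   the multigraph obtained from M. *)
Definition config_graph (n d : nat) (M : {set {set 'I_n * 'I_d}}) :
  sgraph 'I_n := SGraph (config_adj_sym M) (config_adj_irr M).

(* Meaningful when d * n is even; otherwise there is no perfect matching and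
   the value is 0 / 0 = 0. *)
Definition config_prob (R : realType) (n d : nat) (E : sgraph 'I_n -> Prop) :
    R :=
  let PM := perfect_matchings ('I_n * 'I_d)%type in
  (#|[set M in PM | `[< E (config_graph M) >]]|%:R / #|PM|%:R)%R.

(* Main.v *)
(** A graph all of whose small vertex sets fail to separate it in a balanced
way has large tree-width and tree-depth: both a tree decomposition and the
root paths of a rooted forest assign small bags to the nodes of a forest, and
some bag S then splits the remaining vertices into two sides of linear size
with no edge between them.  Let A be the union of S and one side, k = |A|.
Exposing the partners of the half-edges at A \ S one at a time, no such edge
appears with probability at most the product of the (dk - x) / (dn - x) over
the odd x < d |A \ S|.  As d >= 3, the factors for d consecutive odd x are
bounded by two factors of 1 / 'C(n, k) and a spare factor k / n <= 7/8,
so that, up to the number of choices of S, the sum over all A is exponentially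
small; the number of choices of S grows at an arbitrarily small exponential
rate when |S| <= eta n. *)

Require Import Defs.
From HB Require Import structures.
From mathcomp Require Import all_boot all_order all_algebra.
From mathcomp Require Import boolp reals.
From mathcomp Require Import zify ring lra.

Set Implicit Arguments.
Unset Strict Implicit.
Unset Printing Implicit Defensive.

(** * Balanced separators from forests *)

Section Avoid.
Variables (T : finType) (F : sgraph T).

Definition avoid (t : T) : rel T := fun x y => [&& x != t, y != t & F x y].

Lemma avoid_sym t : connect_sym (avoid t).
Proof. by apply: sym_connect_sym => x y; rewrite /avoid adj_sym andbCA. Qed.

Lemma path_avoid t x p : x != t ->
  path (avoid t) x p = path F x p && (t \notin p).
Proof.
elim: p x => [|y p IH] x xt //=; rewrite /avoid xt inE negb_or (eq_sym t y) /=.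
by case: (eqVneq y t) => [->|yt]; rewrite /= ?andbF // IH // andbA.
Qed.

(** A simple path from [u] to [w] off [t], closed up through [t], would be a cycle of at least three
    vertices. *)
Lemma acyclic_avoid t u w : acyclic F -> F t u -> F t w ->
  connect (avoid t) u w -> u = w.
Proof.
move=> acF tu tw /connectP[p up ew]; apply/eqP; apply: contraT => uw.
have ut : u != t by apply: contraTneq tu => ->; rewrite adj_irr.
case/shortenP: up ew => q; rewrite path_avoid // => /andP[uq tq] Uq _ ew.
have /acF : ucycle F [:: t, u & q].
  rewrite /ucycle (cons_uniq t) Uq !inE negb_or eq_sym ut tq /= tu.
  by rewrite rcons_path uq -ew adj_sym tw.
by case: q ew {uq tq Uq} => //= e; rewrite e eqxx in uw.
Qed.

(** If the second vertices differed, they would be two neighbours of [x] joined off [x] through the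
    common end. Hence they agree, and induction applies. *)
Lemma acyclic_uniq_path x p q : acyclic F -> path F x p -> path F x q ->
  uniq (x :: p) -> uniq (x :: q) -> last x p = last x q -> p = q.
Proof.
move=> acF; elim: p x q => [|y p IH] x [|z q] //=.
- by move=> _ _ _ /andP[+ _] e; rewrite e mem_last.
- by move=> _ _ /andP[+ _] _ e; rewrite -e mem_last.
case/andP=> xy yp /andP[xz zq] /andP[xp Up] /andP[xq Uq] e.
have yx : y != x by apply: contraNneq xp => ->; rewrite mem_head.
have zx : z != x by apply: contraNneq xq => ->; rewrite mem_head.
suff yz : y = z by subst z; rewrite (IH y q).
apply: (acyclic_avoid acF xy xz).
move: xp xq; rewrite !inE !negb_or => /andP[_ xp] /andP[_ xq].
apply: (connect_trans (y := last y p)).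
  by apply/connectP; exists p => //; rewrite path_avoid // yp.
by rewrite e avoid_sym; apply/connectP; exists q => //;
  rewrite path_avoid // zq.
Qed.

(* Step from [t] to [t'] in the component K of [x] after removal of [t]: no
   vertex of K reaches [t] any more, so that the components after removal of
   [t'] are either disjoint from K or properly contained in it. *)
Lemma acyclic_step t x : acyclic F -> x != t ->
  exists2 t', connect (avoid t) x t' &
    forall z, connect (avoid t) x z -> connect (avoid t') z t -> False.
Proof.
move=> acF xt.
have notT z : connect (avoid t) x z -> z != t.
  rewrite avoid_sym => /connectP[[|y p] /= + e]; first by rewrite -e.
  by case/andP => /andP[].
(* Step to a neighbour of [t] in K if there is one; otherwise no edge leads from K to [t], and [x]
   itself serves. *)
case: (pickP [pred u | F t u & connect (avoid t) x u]) =>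
  [t' /andP[tt' xt']|no].
  exists t' => // z xz zt; have tt'N : t != t' by rewrite eq_sym notT.
  have zt' : z != t'.
    apply: contraTneq zt => ->; apply/negP => /connectP[[|y p] /= + e].
      by rewrite e eqxx in tt'N.
    by rewrite /avoid eqxx.
  have : connect (avoid t) z t' by rewrite (connect_trans _ xt') // avoid_sym.
  case/connectP => p; case: (lastP p) => [|{}p w]; first by move=> _ /= e;
    rewrite e eqxx in zt'.
  rewrite last_rcons => + ew; rewrite -{}ew => {w} zp.
  case/shortenP: zp (last_rcons z p t') => q.
  case: (lastP q) => [|{}q w]; first by move=> _ _ _ /= e;
    rewrite e eqxx in zt'.
  rewrite last_rcons rcons_path -rcons_cons rcons_uniq => + + _ e; rewrite {w}e.
  rewrite path_avoid ?notT // =>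
    /andP[/andP[zq tq] /and3P[lt' _ Flt']] /andP[t'q Uq].
  (* Both [t] and the last vertex of [q] are neighbours of [t'], and they are joined through [z] off
     [t']. *)
  suff tl : t = last z q by rewrite -tl eqxx in lt'.
  apply: (acyclic_avoid (t := t') acF); rewrite 1?adj_sym //.
  rewrite avoid_sym; apply: connect_trans zt; rewrite avoid_sym.
  apply/connectP; exists q => //; rewrite path_avoid // zq.
  by move: t'q; rewrite inE negb_or => /andP[].
exists x => // z xz /connectP[p zp et].
case/lastP: p zp et => [_ /= e|p w]; first by have := notT _ xz; rewrite e eqxx.
rewrite last_rcons => + ew;
  rewrite -{}ew rcons_path => /andP[zp /and3P[_ _ lt]].
have : forall z, connect (avoid t) x z -> path (avoid x) z p ->
   connect (avoid t) x (last z p).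
  elim: p {z xz zp lt} => //= y p IH z xz /andP[/and3P[_ _ zy]] /IH; apply.
  apply: (connect_trans xz); apply: connect1;
    rewrite /avoid zy (notT _ xz) andbT /=.
  apply: contraTneq zy => ->; apply/negP => zt.
  by have := no z; rewrite /= adj_sym zt xz.
move/(_ _ xz zp) => xl; have := no (last z p).
by rewrite /= adj_sym lt xl.
Qed.

End Avoid.

Section Separation.
Variables (V T : finType) (G : sgraph V) (F : sgraph T) (bag : T -> {set V}).
Hypothesis acF : acyclic F.
Hypothesis bag_vertex : forall v, exists t, v \in bag t.
Hypothesis bag_edge :
  forall u v, G u v -> exists t, (u \in bag t) && (v \in bag t).
Hypothesis bag_connected : forall v s t, v \in bag s -> v \in bag t ->
  connect [rel x y | [&& v \in bag x, v \in bag y & F x y]] s t.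

Definition part t x : {set V} :=
  [set v | v \notin bag t & [exists s,
    (v \in bag s) && connect (avoid F t) x s]].

(** The nodes whose bags contain [v] are connected and avoid [t], so they lie in one component; any
    bag of [v] thus decides its membership in a part. *)
Lemma part_connect t x v s : v \in part t x -> v \in bag s ->
  connect (avoid F t) x s.
Proof.
rewrite inE => /andP[vt /existsP[s' /andP[vs' xs']]] vs.
apply: connect_trans xs' _; apply: connect_sub (bag_connected vs' vs) => a b /=.
case/and3P=> va vb ab; apply: connect1; rewrite /avoid ab andbT.
by apply/andP; split; [apply: contraNneq vt => <- | apply: contraNneq vt => <-].
Qed.

Lemma part_closed t x u v : u \in part t x -> v \notin bag t -> G u v ->
  v \in part t x.
Proof.
move=> ux vt /bag_edge[s /andP[us vs]]; rewrite inE vt /=.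
by apply/existsP; exists s; rewrite vs (part_connect ux us).
Qed.

(* If every bag [bag t] leaves a part with more than half of the vertices, step
   from [t] towards such a part whose component of the forest is smallest. *)
Lemma separator : exists S : {set V},
  (S = set0 \/ exists t, S = bag t) /\
  forall v, v \notin S -> exists W : {set V},
    [/\ v \in W, 2 * #|W| <= #|V| &
        forall u w, u \in W -> w \notin S -> G u w -> w \in W].
Proof.
pose big := [pred p : T * T | (p.2 != p.1) && (#|V| < 2 * #|part p.1 p.2|)].
(* Without nodes there are no vertices, by [bag_vertex], and the empty set serves as separator. *)
suff [T0|[t small]] : (T -> False) \/ exists t, forall x, ~~ big (t, x).
- exists set0; split; first by left.
  by move=> v; have [t _] := bag_vertex v; have := T0 t.
- exists (bag t); split=> [|v vt]; first by right; exists t.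
  have [x vx] := bag_vertex v; exists (part t x); split;
    last exact: part_closed.
    by rewrite inE vt; apply/existsP; exists x; rewrite vx connect0.
  have := small x; rewrite /= negb_and negbK -leqNgt => /orP[/eqP xt|//].
  by rewrite xt (negbTE vt) in vx.
case: (pickP (@predT T)) => [t0 _|T0]; last by left=> t; have := T0 t.
right.
case: (pickP big) => [p0 bp0|no]; last by exists t0 => x; rewrite no.
pose K t x : {set T} := [set z | connect (avoid F t) x z].
case: (@arg_minnP _ p0 big (fun p => #|K p.1 p.2|) bp0) => -[t x] /=.
case/andP=> xt bigx minK; have [t' xt' K't] := acyclic_step acF xt.
have tt' : t != t'.
  by apply/eqP=> tt'; apply: (K't t' xt'); rewrite tt' connect0.
have closed z w : connect (avoid F t) x z -> connect (avoid F t') z w ->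
    connect (avoid F t) x w.
  move=> + /connectP[p zp ->]; elim: p z zp => //= y p IH z /andP[zy yp] xz.
  apply: (IH y yp); apply: (connect_trans xz); apply: connect1.
  case/and3P: (zy) => zt' yt' Fzy; rewrite /avoid Fzy andbT.
  apply/andP; split; apply/eqP => e.
    by apply: (K't z) => //; rewrite e.
  by apply: (K't z) => //; rewrite -e connect1.
exists t' => y; apply/negP => bigy; have /andP[/= yt' bigy'] := bigy.
(* If [y] lies in the component of [x], its component after removal of [t'] is contained in the old
   one and misses [t'], against minimality. *)
case xy: (connect (avoid F t) x y).
  have := minK (t', y) bigy; rewrite leqNgt => /negP; apply; apply: proper_card.
  apply/properP; split; first by apply/subsetP => z; rewrite !inE;
    apply: closed.
  exists t'; rewrite inE // avoid_sym; apply/negP => /connectP[[|z p] /= + e].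
    by rewrite e eqxx in yt'.
  by rewrite /avoid eqxx.
(* Otherwise the two parts are disjoint, yet each has more than half of the vertices. *)
have : [disjoint part t x & part t' y].
  rewrite -setI_eq0; apply/eqP/setP => v; rewrite !inE; apply/negP.
  case/and3P=> /andP[vt /existsP[s /andP[vs xs]]] vt'.
  case/existsP=> s' /andP[vs' ys'].
  move/negP: xy; apply; apply: closed (_ : connect _ s' y);
    last by rewrite avoid_sym.
  by apply: (part_connect _ vs'); rewrite inE vt; apply/existsP; exists s;
    rewrite vs.
rewrite -leq_card_setU => /eqP e.
have : #|part t x :|: part t' y| <= #|V| by apply: max_card.
rewrite e; move: bigx bigy'; set a := #|part t x|; set b := #|part t' y|;
  set c := #|V|.
clearbody a b c; clear; lia.
Qed.

End Separation.

(* Remove from a smallest union of parts of size at least n/4 one of its parts: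
   what remains has fewer than n/4 vertices. *)
Lemma balanced (V : finType) (G : sgraph V) (S : {set V}) : 8 * #|S| <= #|V| ->
  (forall v, v \notin S -> exists W : {set V},
    [/\ v \in W, 2 * #|W| <= #|V| &
        forall u w, u \in W -> w \notin S -> G u w -> w \in W]) ->
  exists A : {set V}, [/\ S \subset A, #|V| <= 4 * #|A :\: S|,
    8 * #|A| <= 7 * #|V| &
    forall u v, u \in A :\: S -> v \notin A -> ~~ G u v].
Proof.
move=> S8 parts; have [V0|Vpos] := posnP #|V|.
  exists setT; split; rewrite ?subsetT ?cardsT ?V0 //.
  by move=> u v _; rewrite inE.
pose P (A : {set V}) := [&& S \subset A, #|V| <= 4 * #|A :\: S| &
  [forall u in A :\: S, forall v in ~: A, ~~ G u v]].
have PT : P setT.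
  apply/and3P; split; first exact: subsetT.
    by have := cardsD setT S; rewrite setTI cardsT; lia.
  by apply/forall_inP=> u _; apply/forall_inP => v; rewrite setCT inE.
case: (@arg_minnP _ _ P (fun A : {set V} => #|A|) PT) =>
  A /and3P[SA A4 clA] minA.
exists A; split=> //; last first.
  by move=> u v uA vA; move/forall_inP/(_ u uA)/forall_inP: clA; apply;
    rewrite inE.
have [v vA] : exists v, v \in A :\: S by apply/card_gt0P; lia.
have [vS vA'] : v \notin S /\ v \in A by move: vA; rewrite inE => /andP[].
have [W [vW W2 clW]] := parts _ vS.
have WS : A :\: (W :\: S) :\: S = (A :\: S) :\: W.
  by apply/setP=> x; rewrite !inE; case: (x \in S); rewrite /= ?andbF ?andbT.
case: (boolP (P (A :\: (W :\: S)))) => [/minA|].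
  rewrite leqNgt => /negP[]; apply: proper_card; apply/properP.
  by split; [exact: subsetDl | exists v; rewrite // !inE vS vW].
rewrite /P WS; have -> : S \subset A :\: (W :\: S).
  by apply/subsetP => x xS; rewrite !inE xS (subsetP SA).
have -> /= : [forall u in A :\: S :\: W, forall v in ~: (A :\: (W :\: S)),
  ~~ G u v].
  apply/forall_inP => x; rewrite !inE => /and3P[xW xS xA].
  apply/forall_inP => y; rewrite !inE negb_and negbK => /orP[/andP[yS yW]|yA].
    by apply: contra xW; rewrite adj_sym => /clW; apply.
  move/forall_inP/(_ x): clA; rewrite inE xS xA => /(_ isT)/forall_inP; apply.
  by rewrite inE.
(* The smaller set can only violate the size condition, so |A \ S| < n/4 + n/2; with |S| <= n/8 this
   gives |A| <= 7n/8. *)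
rewrite andbT -ltnNge; have := cardsD (A :\: S) W; have := cardsD A S.
have : #|(A :\: S) :&: W| <= #|W| by apply/subset_leq_card/subsetIr.
have : #|A :&: S| <= #|S| by apply/subset_leq_card/subsetIr.
have : #|A :&: S| <= #|A| by apply/subset_leq_card/subsetIl.
have : #|(A :\: S) :&: W| <= #|A :\: S| by apply/subset_leq_card/subsetIl.
move: S8 A4 W2; set a := #|A|; set b := #|A :\: S|; set c := #|V|;
  set w := #|W|.
set p := #|_ :&: W|; set q := #|_ :&: S|; set r := #|_ :\: W|; set s := #|S|.
clearbody a b c w p q r s; clear; lia.
Qed.

(** * Separability from small tree-width or tree-depth *)

Definition separable (V : finType) (G : sgraph V) (k : nat) :=
  exists A S : {set V}, [/\ S \subset A, #|S| <= k, #|V| <= 4 * #|A :\: S|,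
    8 * #|A| <= 7 * #|V| &
    forall u v, u \in A :\: S -> v \notin A -> ~~ G u v].

(** The index graph [F] may be any forest, so that tree decompositions and rooted forests are
    treated alike. *)
Lemma forest_decomposition_separable (V T : finType) (G : sgraph V)
    (F : sgraph T) (bag : T -> {set V}) (k : nat) :
  acyclic F -> (forall v, exists t, v \in bag t) ->
  (forall u v, G u v -> exists t, (u \in bag t) && (v \in bag t)) ->
  (forall v s t, v \in bag s -> v \in bag t ->
    connect [rel x y | [&& v \in bag x, v \in bag y & F x y]] s t) ->
  (forall t, #|bag t| <= k) -> 8 * k <= #|V| -> separable G k.
Proof.
move=> acF bv be bc bk kV; have [S [Sbag parts]] := separator acF bv be bc.
have Sk : #|S| <= k by case: Sbag => [->|[t ->] //]; rewrite cards0.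
have [|A [SA A4 A8 nG]] := balanced _ parts; last by exists A, S.
by apply: leq_trans kV; rewrite leq_mul2l.
Qed.

Lemma treewidth_separable (V : finType) (G : sgraph V) (k : nat) :
  treewidth G < k -> 8 * k <= #|V| -> separable G k.
Proof.
rewrite /treewidth; case: ex_minnP => w /asboolP[T [D wE]] _ wk.
move: wk; rewrite -{}wE; case: D => F bag [T0 FT acF] bv be bc wk;
  apply: (forest_decomposition_separable acF bv be bc) => t.
(* [width] is the largest bag size minus one, hence the strict bound on the tree-width. *)
apply: leq_trans wk; rewrite /width /=; apply: leq_trans (leqSpred _).
exact: (@leq_bigmax _ (fun t => #|bag t|)).
Qed.

Section RootPath.
Variables (V : finType) (F : rooted_forest V).

Lemma root_path_ex y : exists p, root_path F y p.
Proof.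
have [r [[r0 /connectP[q rq yq]] _]] := forest_root F y.
case/shortenP: rq yq => q' rq' Uq' _ yq'.
by exists (r :: q'); apply/and4P; split=> //; apply/eqP.
Qed.

Lemma root_path_uniq y p p' : root_path F y p -> root_path F y p' -> p = p'.
Proof.
case: p p' => // r q [] // r' q'.
case/and4P=> r0 rq Uq /eqP lq /and4P[r0' rq' Uq' /eqP lq'].
have [z [_ uz]] := forest_root F y.
have er : r = r'.
  rewrite -(uz r) ?(uz r') //; split=> //; apply/connectP.
    by exists q'.
  by exists q.
subst r'; congr cons.
apply: (acyclic_uniq_path (@forest_acyclic _ F) rq rq' Uq Uq').
by rewrite lq lq'.
Qed.

Definition ancestors y : {set V} := [set x | `[< ancestor F x y >]].

Lemma mem_ancestors y p : root_path F y p -> ancestors y =i p.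
Proof.
move=> yp x; rewrite inE; apply/asboolP/idP => [[p' yp']|xp]; last by exists p.
by rewrite (root_path_uniq yp yp').
Qed.

Lemma ancestors_refl y : y \in ancestors y.
Proof.
have [p yp] := root_path_ex y; rewrite (mem_ancestors yp).
by case: p yp => // r q /and4P[_ _ _ /eqP <-]; apply: mem_last.
Qed.

Lemma card_ancestors y : #|ancestors y| <= height F.
Proof.
have [p yp] := root_path_ex y; rewrite (eq_card (mem_ancestors yp)).
have Up : uniq p by case: p yp => // r q /and4P[].
have pV : size p < #|V|.+1 by rewrite ltnS -(card_uniqP Up) max_card.
rewrite (card_uniqP Up); apply: (bigmax_sup (Ordinal pV)) => //.
by apply/asboolP; exists y, p.
Qed.

(** Every nonempty initial segment of a root path is a root path, so going down from [x] to [y] only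
    meets vertices that have [x] as an ancestor. *)
Lemma ancestors_connect x y : x \in ancestors y ->
  connect [rel a b | [&& x \in ancestors a, x \in ancestors b & F a b]] x y.
Proof.
have [p yp] := root_path_ex y; rewrite (mem_ancestors yp).
case: p yp => // r q yq xq; case/splitPl: xq yq => q1 q2 lq1.
have xq q0 : x \in r :: q1 ++ q0 by rewrite -cat_cons mem_cat -lq1 mem_last.
elim/last_ind: q2 y => [|q2 w IH] y.
  by rewrite cats0 => /and4P[_ _ _ /eqP <-]; rewrite lq1 connect0.
move=> yq; have := xq (rcons q2 w); rewrite -(mem_ancestors yq) => xy.
case/and4P: yq => r0; rewrite -rcons_cat -rcons_cons rcons_path rcons_uniq.
case/andP=> rq ly /andP[_ Uq]; rewrite last_rcons => /eqP wy.
have lq : root_path F (last r (q1 ++ q2)) (r :: q1 ++ q2) by apply/and4P.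
apply: connect_trans (IH _ lq) (connect1 _).
by rewrite /= (mem_ancestors lq) xq xy -wy ly.
Qed.

End RootPath.

Lemma treedepth_separable (V : finType) (G : sgraph V) (k : nat) :
  treedepth G <= k -> 8 * k <= #|V| -> separable G k.
Proof.
rewrite /treedepth; case: ex_minnP => h /asboolP[F [GF hE]] _ hk.
apply: (@forest_decomposition_separable _ _ _ F (ancestors F)).
- exact: forest_acyclic.
- by move=> v; exists v; apply: ancestors_refl.
- move=> u v /GF[_ [uv|vu]]; [exists v | exists u];
  rewrite ancestors_refl ?andbT inE;
    exact/asboolP.
- move=> v s t vs vt; apply: connect_trans (ancestors_connect vt).
  rewrite sym_connect_sym; first exact: ancestors_connect.
  by move=> a b /=; rewrite adj_sym andbCA.
- by move=> t; apply: leq_trans (card_ancestors F t) _; rewrite hE.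
Qed.

(** * Counting perfect matchings *)

Section Matchings.
Variable H : finType.
Implicit Types (X A B : {set H}) (M : {set {set H}}).

(** Matchings of a subset [X], so that matched pairs can be deleted one after the other; for
    [X = setT] these are the [perfect_matchings]. *)
Definition matchings X : {set {set {set H}}} :=
  [set M : {set {set H}} | partition M X & [forall B in M, #|B| == 2]].

(* The double factorial (n - 1)!! if n is even, and 0 if n is odd. *)
Fixpoint num_matchings n : nat :=
  if n is m.+2 then m.+1 * num_matchings m else (n == 0).

Lemma matching_pair_inj X M x y z : M \in matchings X ->
  [set x; y] \in M -> [set x; z] \in M -> y != x -> y = z.
Proof.
rewrite inE => /andP[/partition_trivIset tM _] yM zM yx.
have : [set x; y] = [set x; z].
  by rewrite -(def_pblock tM yM (set21 x y)) -(def_pblock tM zM (set21 x z)).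
by move/setP/(_ y); rewrite !inE eqxx orbT (negbTE yx) => /esym/eqP.
Qed.

Lemma matching_mate X M x : M \in matchings X -> x \in X ->
  exists2 y, y \in X :\ x & [set x; y] \in M.
Proof.
rewrite inE => /andP[pM /forall_inP M2] xX.
have xM : x \in cover M by rewrite (cover_partition pM).
have BM := pblock_mem xM; have := xM; rewrite -mem_pblock => xB.
have [a [b [ab eB]]] := @cards2P _ _ (M2 _ BM).
have BX := subsetP (partitionS pM BM).
rewrite eB in BM BX xB.
case/set2P: xB => ->; [exists b | exists a];
  rewrite ?inE // 1?(setUC [set b]) //.
  by rewrite eq_sym ab BX ?set22.
by rewrite ab BX ?set21.
Qed.

(** Deleting the pair is a bijection; [Q] stands for a condition on the full matching, to be carried
    along the exposure. *)
Lemma card_matchings_pair X (Q : pred {set {set H}}) x y :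
  x \in X -> y \in X :\ x ->
  #|[set M in matchings X | Q M & [set x; y] \in M]| =
  #|[set M in matchings (X :\: [set x; y]) | Q ([set x; y] |: M)]|.
Proof.
move=> xX; rewrite !inE => /andP[yx yX]; set D := [set x; y].
have DX : D \subset X by apply/subsetP => z /set2P[] ->.
have notD M : M \in matchings (X :\: D) -> D \notin M.
  rewrite inE => /andP[pM _]; apply/negP => /(partitionS pM)/subsetP/(_ x).
  by rewrite !inE eqxx => /(_ isT).
rewrite -[RHS](@card_in_imset _ _ (fun M => D |: M)); last first.
  move=> M M'; rewrite [M \in _]in_set [M' \in _]in_set =>
    /andP[mM _] /andP[mM' _] e.
  by rewrite -(setU1K (notD M mM)) e setU1K // notD.
apply: eq_card => M; rewrite !inE; apply/idP/imsetP.
  case/andP => /andP[pM /forall_inP M2] /andP[QM DM].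
  exists (M :\ D); rewrite ?setD1K // !inE setD1K // QM andbT.
  rewrite partitionD1 //=; apply/forall_inP => E; rewrite inE => /andP[_];
    exact: M2.
case=> M'; rewrite !inE => /andP[/andP[pM /forall_inP M2] QM] ->.
rewrite QM setU11 /= andbT; apply/andP; split.
  have -> : X = D :|: (X :\: D) by rewrite setDE setUIr setUCr setIT;
    apply/esym/setUidPr.
  apply: partitionU1 => //; first by apply/set0Pn; exists x; rewrite set21.
  by rewrite -setI_eq0 setIDA setIC -setIDA setDv setI0.
by apply/forall_inP => E /setU1P[->|/M2 //]; rewrite cards2 (eq_sym x) yx.
Qed.

Lemma card_matchings_rec X (Q : pred {set {set H}}) x : x \in X ->
  #|[set M in matchings X | Q M]| =
  \sum_(y in X :\ x)
     #|[set M in matchings (X :\: [set x; y]) | Q ([set x; y] |: M)]|.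
Proof.
(* The default [x] lies outside [X :\ x], so it is never taken for a partner. *)
move=> xX; pose mate M := odflt x [pick y | (y != x) && ([set x; y] \in M)].
have mateE M y : M \in matchings X -> y != x ->
    (mate M == y) = ([set x; y] \in M).
  move=> mM yx; rewrite /mate; case: pickP => [z /andP[zx zM]|no] /=.
    by apply/eqP/idP => [<- //|yM]; exact: matching_pair_inj mM zM yM zx.
  by have := no y; rewrite yx /= => ->; rewrite eq_sym (negbTE yx).
rewrite -sum1_card (partition_big mate (mem (X :\ x))) /=; last first.
  move=> M; rewrite inE => /andP[mM _]; have [y yX yM] := matching_mate mM xX.
  have yx : y != x by move: yX; rewrite !inE => /andP[].
  by have := mateE M y mM yx; rewrite yM => /eqP ->.
apply: eq_bigr => y yX; rewrite -(card_matchings_pair _ xX yX) sum1_card.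
have yx : y != x by move: yX; rewrite !inE => /andP[].
apply: eq_card => M; rewrite -[LHS]/((M \in _) && (mate M == y)) in_set
  [RHS]in_set -andbA.
by case: (boolP (M \in matchings X)) => //= mM; rewrite mateE.
Qed.

Lemma cardsD_pair X x y : x \in X -> y \in X :\ x ->
  #|X| = #|X :\: [set x; y]|.+2.
Proof.
by move=> xX yX; rewrite (cardsD1 x X) xX (cardsD1 y) yX setDDl.
Qed.

Lemma card_matchings X : #|matchings X| = num_matchings #|X|.
Proof.
have [n] := ubnP #|X|; elim: n X => // n IH X Xn.
have [->|/set0Pn[x xX]] := eqVneq X set0.
  rewrite cards0 /= (_ : matchings _ = [set set0]) ?cards1 //.
  apply/setP=> M; rewrite !inE partition_set0; case: eqP => //= ->.
  by apply/forall_inP => E; rewrite inE.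
have -> : matchings X = [set M in matchings X | true] by apply/setP => M;
  rewrite in_set andbT.
have X1 : #|X| = #|X :\ x|.+1 by rewrite (cardsD1 x X) xX.
have H1 y : y \in X :\ x ->
    #|matchings (X :\: [set x; y])| = num_matchings #|X|.-2.
  move=> yX; have := cardsD_pair xX yX => e; rewrite IH; first by rewrite e.
  by rewrite e in Xn; lia.
rewrite (card_matchings_rec _ xX) (eq_bigr (fun=> num_matchings #|X|.-2));
  last first.
  by move=> y yX; rewrite -(H1 y yX); apply: eq_card => M; rewrite in_set andbT.
rewrite sum_nat_const X1; case E: #|X :\ x| => [|m] //=.
Qed.

Definition avoiding A B : pred {set {set H}} := fun M =>
  [forall u in A, forall v in B, [set u; v] \notin M].

(* Expose the partners of j vertices of A one at a time: when the next one is
   exposed, none of the #|B| vertices of B has been matched to A yet. *)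
Lemma card_avoiding A B X j : B \subset X -> 2 * j <= #|A :&: X| ->
  [disjoint A & B] ->
  #|[set M in matchings X | avoiding A B M]| <=
  \prod_(t < j) (#|X| - #|B| - (2 * t).+1) * num_matchings (#|X| - 2 * j).
Proof.
move=> + + AB; elim: j X => [|j IH] X BX jA.
  rewrite big_ord0 mul1n subn0 -card_matchings; apply: subset_leq_card.
  by apply/subsetP => M; rewrite in_set => /andP[].
have [x xAX] : exists x, x \in A :&: X by apply/card_gt0P; lia.
have [xA xX] : x \in A /\ x \in X by move: xAX; rewrite inE => /andP[].
have xB : x \notin B by rewrite (disjointFr AB).
rewrite (card_matchings_rec _ xX).
set c := \prod_(t < j) (#|X|.-2 - #|B| - (2 * t).+1) *
  num_matchings (#|X|.-2 - 2 * j).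
apply: (@leq_trans (\sum_(y in X :\ x :\: B) c)).
  rewrite [leqLHS]big_mkcond [leqRHS]big_mkcond; apply: leq_sum => y _.
  rewrite [y \in _ :\: B]in_setD; case: ifP => yX; last by rewrite andbF.
  case yB: (y \in B) => /=.
    rewrite leqn0 cards_eq0; apply/eqP/setP => M; rewrite !inE;
      apply/negP => /andP[_].
    by move/forall_inP/(_ x xA)/forall_inP/(_ y yB); rewrite setU11.
  have e := cardsD_pair xX yX.
  have -> : c = \prod_(t < j) (#|X :\: [set x; y]| - #|B| - (2 * t).+1) *
      num_matchings (#|X :\: [set x; y]| - 2 * j).
    by rewrite /c e.
  apply: leq_trans (IH _ _ _).
  - apply: subset_leq_card; apply/subsetP => M; rewrite !in_set => /andP[->] /=.
    move/forall_inP => h; apply/forall_inP => u uA; apply/forall_inP => v vB.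
    by have /forall_inP/(_ v vB) := h u uA; apply: contra; apply: setU1r.
  - apply/subsetP => z zB; rewrite !inE (subsetP BX) // andbT negb_or.
    by apply/andP; split; [apply: contraTneq zB => ->
      | apply: contraTneq zB => ->; rewrite yB].
  - have : #|A :&: X| <= #|A :&: (X :\: [set x; y])| + 2.
      rewrite -(cardsID [set x; y] (A :&: X)) addnC -setIDA leq_add2l.
      apply: leq_trans (subset_leq_card (subsetIr _ _)) _; rewrite cards2;
        by case: eqP.
    lia.
rewrite sum_nat_const big_ord_recl muln0.
have -> : #|(X :\ x) :\: B| = #|X| - #|B| - 1.
  have -> : #|X| = #|X :\ x|.+1 by rewrite (cardsD1 x X) xX.
  have BX1 : B \subset X :\ x by rewrite subsetD1 BX xB.
  by rewrite cardsD (setIidPr BX1) subSn ?subn1 // subset_leq_card.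
rewrite -mulnA leq_mul2l; apply/orP; right; rewrite /c.
apply: eq_leq => /=.
congr (_ * num_matchings _); last by lia.
apply: eq_bigr => t _; rewrite /bump /=; lia.
Qed.

(** Splits off the first [j] factors of the double factorial, to be compared with the product in
    [card_avoiding]. *)
Lemma num_matchings_prod n j : 2 * j <= n ->
  num_matchings n = \prod_(t < j) (n - (2 * t).+1) * num_matchings (n - 2 * j).
Proof.
elim: j n => [|j IH] n jn; first by rewrite big_ord0 mul1n subn0.
case: n jn => [|[|n]] jn; [lia | lia|].
rewrite big_ord_recl /= IH; last by lia.
rewrite -mulnA muln0 subSS subn0; congr (_ * (_ * num_matchings _));
  last by lia.
by apply: eq_bigr => t _; rewrite /bump /=; lia.
Qed.

Lemma num_matchings_gt0 n : ~~ odd n -> 0 < num_matchings n.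
Proof.
have [m] := ubnP n; elim: m n => // m IH [|[|n]] //= nm; rewrite negbK => on.
by rewrite muln_gt0 IH //; lia.
Qed.

End Matchings.

(** * The union bound *)

Import Order.TTheory GRing.Theory Num.Theory.

Lemma bin_diag2 n k : k.+2 * k.+1 * 'C(n.+2, k.+2) = n.+2 * n.+1 * 'C(n, k).
Proof.
by rewrite mulnAC -mul_bin_diag mulnAC -(mulnA _ k.+1) -mul_bin_diag -mulnA
  mulnCA mulnA.
Qed.

(* The factors i = 0 and i = d - 1 of the products account for the change of the
   binomial coefficient, the factor i = 1 (available because d >= 3) for the
   additional ratio (k + 2 + 2m) / (n + 2 + 2m). *)
Lemma prod_step d n k m : 2 < d -> k <= n ->
  \prod_(i < d) (k.+2 * d - (2 * i).+1) * (n.+2 + 2 * m) * 'C(n.+2, k.+2) <=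
  \prod_(i < d) (n.+2 * d - (2 * i).+1) * (k.+2 + 2 * m) * 'C(n, k).
Proof.
case: d => [|[|[|e]]] // _ kn; rewrite -(@leq_pmul2l (k.+2 * k.+1)) //.
set X := \prod_(i < _) _; set Y := \prod_(i < _) _.
have -> : k.+2 * k.+1 * (X * (n.+2 + 2 * m) * 'C(n.+2, k.+2)) =
    X * (n.+2 + 2 * m) * (n.+2 * n.+1) * 'C(n, k).
  by rewrite mulnCA bin_diag2 !mulnA.
have -> : k.+2 * k.+1 * (Y * (k.+2 + 2 * m) * 'C(n, k)) =
    Y * (k.+2 + 2 * m) * (k.+2 * k.+1) * 'C(n, k).
  by rewrite mulnA (mulnC (_ * k.+1)).
apply: leq_mul => //; rewrite /X 2!big_ord_recl big_ord_recr /Y 2!big_ord_recl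
  big_ord_recr /= !muln0 /bump /=.
set p := \prod_(i < e) _; set q := \prod_(i < e) _.
have pq : p <= q.
  by apply: leq_prod => i _; rewrite leq_sub2r // leq_mul2r !ltnS kn orbT.
have h0 : (k.+2 * e.+3 - 1) * n.+2 <= (n.+2 * e.+3 - 1) * k.+2.
  by rewrite !mulnBl; apply: leq_sub; lia.
have h1 : (k.+2 * e.+3 - 3) * (n.+2 + 2 * m) <=
    (n.+2 * e.+3 - 3) * (k.+2 + 2 * m).
  rewrite !mulnBl; apply: leq_sub; last by lia.
  have := leq_mul (leq_mul kn (leqnn e.+3)) (leqnn m); lia.
have h2 : (k.+2 * e.+3 - (2 * e.+2).+1) * n.+1 <=
    (n.+2 * e.+3 - (2 * e.+2).+1) * k.+1.
  have E x : x.+2 * e.+3 - (2 * e.+2).+1 = (x * e.+3).+1 by lia.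
  rewrite !E.
  have := leq_mul kn (leqnn e.+2); lia.
have := leq_mul (leq_mul (leq_mul h0 h1) pq) h2.
rewrite addn0 !add1n muln1; congr (_ <= _); ring.
Qed.

(** Induction on [m]: each block of [d] factors lowers [n] and [k] by 2, and the shift by [2 * m] in
    [prod_step] makes every spare ratio equal to k/n. *)
Lemma prod_ratio d n k m : 2 < d -> 2 * m <= k -> k <= n ->
  \prod_(t < d * m) (k * d - (2 * t).+1) * n ^ m * 'C(n, k) <=
  \prod_(t < d * m) (n * d - (2 * t).+1) * k ^ m * 'C(n - 2 * m, k - 2 * m).
Proof.
move=> d3 + kn; elim: m => [|m IH] mk; first by rewrite muln0 !big_ord0 !subn0.
have E x : 2 * m.+1 <= x -> \prod_(t < d * m.+1) (x * d - (2 * t).+1) =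
    \prod_(t < d * m) (x * d - (2 * t).+1) *
    \prod_(i < d) ((x - 2 * m.+1).+2 * d - (2 * i).+1).
  move=> mx; rewrite mulnSr big_split_ord; congr (_ * _);
    apply: eq_bigr => i _ /=.
  have [y ->] : exists y, x = y + 2 * m.+1 by exists (x - 2 * m.+1); lia.
  rewrite addnK; lia.
rewrite !E //; last by lia.
have /IH {}IH : 2 * m <= k by lia.
have := @prod_step d (n - 2 * m.+1) (k - 2 * m.+1) m d3 (leq_sub2r _ kn).
have e x : 2 * m.+1 <= x -> (x - 2 * m.+1).+2 = x - 2 * m by lia.
have e' x : 2 * m.+1 <= x -> (x - 2 * m.+1).+2 + 2 * m = x by lia.
rewrite !e' ?(e k) ?(e n) //; try lia.
set p := \prod_(i < d) _; set q := \prod_(i < d) _.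
move: IH; set P := \prod_(i < _) _; set Q := \prod_(i < _) _ => IH step.
apply: (@leq_trans (Q * k ^ m * (p * n * 'C(n - 2 * m, k - 2 * m)))).
  have := leq_mul IH (leqnn (p * n)); rewrite expnSr; lia.
have := leq_mul (leqnn (Q * k ^ m)) step; rewrite expnSr; lia.
Qed.

Lemma leq_card_union (I T : finType) (P : pred I) (E : I -> {set T})
    (D : {set T}) :
  (forall x, x \in D -> exists2 i, P i & x \in E i) ->
  #|D| <= \sum_(i | P i) #|E i|.
Proof.
move=> DE; rewrite -sum1_card.
rewrite (eq_bigr (fun i => \sum_(x | x \in E i) 1)); last by move=> i _;
  rewrite sum1_card.
rewrite (exchange_big_dep predT) //= [leqRHS](bigID (mem D)) /=.
apply: leq_trans (leq_addr _ _); apply: leq_sum => x xD.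
have [i Pi xi] := DE x xD.
by rewrite sum1_card; apply/card_gt0P; exists i; apply/andP.
Qed.

Definition bin_sum n s := \sum_(i < s.+1) 'C(n, i).

Lemma card_small_sets (V : finType) s :
  #|[set S : {set V} | #|S| <= s]| <= bin_sum #|V| s.
Proof.
rewrite /bin_sum (eq_bigr (fun i : 'I_s.+1 =>
  #|[set S : {set V} | #|S| == i]|)).
  apply: leq_card_union => S; rewrite inE -ltnS => Ss.
  by exists (Ordinal Ss); rewrite ?inE.
by move=> i _; rewrite card_draws.
Qed.

(* Expand (M + 1) ^ n: the terms with i <= s have a weight of at least
   M ^ (n - s). *)
Lemma bin_sum_bound M n s : 0 < M -> s <= n ->
  bin_sum n s * M ^ (n - s) <= M.+1 ^ n.
Proof.
move=> M0 sn; rewrite -add1n addnC expnDn /bin_sum big_distrl /=.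
rewrite (big_ord_widen_cond n.+1 xpredT (fun i => 'C(n, i) * M ^ (n - s))) //=.
rewrite [leqRHS](bigID (fun i : 'I_n.+1 => i < s.+1)) /=.
apply: leq_trans (leq_addr _ _); apply: leq_sum => i; rewrite ltnS => si.
by rewrite exp1n muln1 leq_mul // leq_pexp2l // leq_sub2l.
Qed.

(** * Configurations without edges across a separation *)

Definition half_edges n d (A : {set 'I_n}) : {set 'I_n * 'I_d} :=
  setX A [set: 'I_d].

Lemma card_half_edges n d (A : {set 'I_n}) : #|half_edges d A| = #|A| * d.
Proof. by rewrite cardsX cardsT card_ord. Qed.

(** Absence of edges between A \ S and the complement of A, expressed on half-edges so that
    [card_avoiding] applies. *)
Definition isolating n d (A S : {set 'I_n}) : {set {set {set 'I_n * 'I_d}}} :=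
  [set M in matchings setT |
    avoiding (half_edges d (A :\: S)) (half_edges d (~: A)) M].

Lemma separable_isolating n d k (M : {set {set 'I_n * 'I_d}}) :
  M \in perfect_matchings _ -> separable (config_graph M) k ->
  exists A S : {set 'I_n}, [/\ S \subset A, #|S| <= k, n <= 4 * #|A :\: S|,
    8 * #|A| <= 7 * n & M \in isolating d A S].
Proof.
move=> MP [A [S [SA Sk A4 A8 noG]]]; rewrite card_ord in A4 A8.
exists A, S; split=> //; rewrite in_set; apply/andP; split; first exact: MP.
apply/forall_inP => -[u i]; rewrite in_setX => /andP[uA _].
apply/forall_inP => -[v j]; rewrite in_setX in_setC => /andP[vA _].
have := noG u v uA vA; apply: contra => uvM.
have uA' : u \in A by move: uA; rewrite inE => /andP[].
rewrite /= /config_adj (_ : u != v); last by apply: contraNneq vA => <-.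
by apply/existsP; exists i; apply/existsP; exists j.
Qed.

Local Open Scope ring_scope.

Lemma isolating_ratio (R : realFieldType) n d s (A S : {set 'I_n}) :
  (2 < d)%N -> ~~ odd (d * n) -> S \subset A -> (#|S| <= s)%N ->
  (n <= 4 * #|A :\: S|)%N -> (8 * #|A| <= 7 * n)%N -> (0 < n)%N ->
  #|isolating d A S|%:R / (num_matchings (n * d))%:R <=
    (bin_sum n s.+1)%:R / 'C(n, #|A|)%:R * (7 / 8) ^+ (n %/ 8).-1 :> R.
Proof.
move=> d3 evn SA Ss A4 A8 n0; set k := #|A|; set a := #|A :\: S| in A4 *.
(* Exposing [d * m] pairs consumes at most 2dm half-edges, no more than there are at A \ S. *)
pose m := a./2.
have ak : (k = a + #|S|)%N by rewrite /a cardsD (setIidPr SA) subnK //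
  subset_leq_card.
have kn : (k <= n)%N by rewrite -[n in leqRHS]card_ord max_card.
have jA : (2 * (d * m) <= #|half_edges d (A :\: S) :&: setT|)%N.
  by rewrite setIT card_half_edges -/a mulnCA mulnC leq_mul2r; apply/orP;
    right; rewrite /m; lia.
have AB : [disjoint half_edges d (A :\: S) & half_edges d (~: A)].
  rewrite -setI_eq0; apply/eqP/setP => -[u i]; rewrite !inE /= !andbT.
  by case: (u \in A); rewrite ?andbF.
have := card_avoiding (subsetT _) jA AB; rewrite -/(isolating d A S).
rewrite cardsT card_prod !card_ord card_half_edges.
have -> : #|~: A| = (n - k)%N by rewrite cardsCs setCK card_ord.
have jn : (2 * (d * m) <= n * d)%N.
  apply: leq_trans jA _; rewrite setIT card_half_edges leq_mul2r; apply/orP;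
    right.
  by rewrite -[n in leqRHS]card_ord max_card.
rewrite -mulnBl subKn // => cI.
have nm := num_matchings_prod jn.
have nm0 : (0 < num_matchings (n * d))%N by rewrite num_matchings_gt0 // mulnC.
have mk : (2 * m <= k)%N by rewrite /m; lia.
have := prod_ratio d3 mk kn.
move: cI nm nm0; set P := (\prod_(t < _) _)%N; set Q := (\prod_(t < _) _)%N.
set N := num_matchings (n * d); set N' := num_matchings _ => cI nm nm0 PQ.
have [Q0 N'0] : (0 < Q)%N /\ (0 < N')%N by apply/andP; rewrite -muln_gt0 -nm.
have C0 : (0 < 'C(n, k))%N by rewrite bin_gt0.
(* Halving leaves over at most one vertex of A \ S, so k - 2m <= |S| + 1; this is where [s.+1] comes
   from. *)
have Ck : ('C(n - 2 * m, k - 2 * m) <= bin_sum n s.+1)%N.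
  have ks : (k - 2 * m < s.+2)%N by rewrite /m; lia.
  apply: (leq_trans (leq_bin2l _ (leq_subr _ _))).
  rewrite /bin_sum (bigD1 (Ordinal ks)) //=; exact: leq_addr.
have mn : ((n %/ 8).-1 <= m)%N by rewrite /m; lia.
apply: (@le_trans _ _ (P%:R / Q%:R)).
  rewrite ler_pdivrMr ?ltr0n // mulrAC ler_pdivlMr ?ltr0n // -!natrM ler_nat nm.
  by rewrite (mulnCA P) mulnC leq_mul2l cI orbT.
apply: (@le_trans _ _ ('C(n - 2 * m, k - 2 * m)%:R / 'C(n, k)%:R
    * (k%:R / n%:R) ^+ m)).
  rewrite expr_div_n mulf_div ler_pdivrMr ?ltr0n // mulrAC ler_pdivlMr;
    last first.
    by rewrite -natrX -natrM ltr0n muln_gt0 C0 expn_gt0 n0.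
  rewrite -!natrX -!natrM ler_nat; lia.
apply: ler_pM.
- by rewrite divr_ge0.
- by rewrite exprn_ge0 // divr_ge0.
- by rewrite ler_pM2r ?invr_gt0 ?ltr0n // ler_nat.
- apply: (@le_trans _ _ ((7 / 8) ^+ m)).
    apply: lerXn2r; rewrite ?nnegrE ?divr_ge0 //.
    rewrite ler_pdivrMr ?ltr0n // mulrAC ler_pdivlMr //.
    by rewrite -!natrM ler_nat mulnC.
  by apply: ler_wiXn2l => //; lra.
Qed.

(** Each of the n + 1 possible cardinalities contributes exactly 1. *)
Lemma sum_inv_bin (R : realFieldType) n :
  \sum_(A : {set 'I_n}) 'C(n, #|A|)%:R^-1 = n.+1%:R :> R.
Proof.
have cA (A : {set 'I_n}) : (#|A| < n.+1)%N.
  by rewrite ltnS -[n in leqRHS]card_ord max_card.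
rewrite (partition_big (fun A => Ordinal (cA A)) xpredT) //=.
rewrite (eq_bigr (fun=> 1)) ?sumr_const ?card_ord // => i _.
rewrite (eq_bigr (fun=> 'C(n, i)%:R^-1)) => [|A /eqP <- //].
rewrite sumr_const (_ : #|_| = 'C(n, i)).
  by rewrite -[LHS]mulr_natr mulVf // pnatr_eq0 -lt0n bin_gt0 -ltnS.
by have := card_draws 'I_n i; rewrite card_ord => <-; apply: eq_card => A;
  rewrite !inE.
Qed.

(** Union bound over the pairs (A, S): one factor [bin_sum] comes from [isolating_ratio], the other
    counts the sets S, and the inverse binomials sum to n + 1. *)
Lemma separable_prob (R : realType) n d s : (2 < d)%N -> ~~ odd (d * n) ->
  (0 < n)%N ->
  config_prob R d (fun G : sgraph 'I_n => separable G s) <=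
    n.+1%:R * (bin_sum n s.+1)%:R ^+ 2 * (7 / 8) ^+ (n %/ 8).-1.
Proof.
move=> d3 evn n0; rewrite /config_prob /=.
have -> : #|perfect_matchings ('I_n * 'I_d)%type| = num_matchings (n * d).
  by rewrite (@card_matchings _ [set: _]) cardsT card_prod !card_ord.
set q := (7 / 8) ^+ _; set W := bin_sum _ _; set N := num_matchings _.
pose P := [pred p : {set 'I_n} * {set 'I_n} | [&& p.2 \subset p.1, #|p.2| <= s,
  n <= 4 * #|p.1 :\: p.2| & 8 * #|p.1| <= 7 * n]%N].
pose F (A : {set 'I_n}) : R := W%:R / 'C(n, #|A|)%:R * q.
have F0 A : 0 <= F A by rewrite !mulr_ge0 ?invr_ge0 ?exprn_ge0 ?divr_ge0.
apply: (@le_trans _ _ (\sum_(p | P p) #|isolating d p.1 p.2|%:R / N%:R)).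
  rewrite -mulr_suml ler_wpM2r ?invr_ge0 // -natr_sum ler_nat.
  apply: leq_card_union => M; rewrite inE => /andP[MP /asboolP].
  case/(separable_isolating MP) => A [S [SA Ss A4 A8 MAS]].
  by exists (A, S) => //=; apply/and4P.
apply: (@le_trans _ _ (\sum_(p | P p) F p.1)).
  apply: ler_sum => -[A S] /and4P[/= SA Ss A4 A8]; exact: isolating_ratio.
(* Keeping only the bound on |S| makes the sums over A and S independent. *)
apply: (@le_trans _ _ (\sum_(p : {set 'I_n} * {set 'I_n} |
    true && (#|p.2| <= s)%N) F p.1)).
  rewrite [leLHS]big_mkcond [leRHS]big_mkcond; apply: ler_sum => -[A S] _ /=.
  by case: ifP => [/and4P[_ -> //]|_]; case: ifP.
rewrite -(pair_big xpredT (fun S : {set 'I_n} => (#|S| <= s)%N)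
  (fun A _ => F A)) /=.
apply: (@le_trans _ _ (\sum_(A : {set 'I_n})
    (W%:R ^+ 2 * q) * 'C(n, #|A|)%:R^-1)).
  apply: ler_sum => A _; rewrite sumr_const -[leLHS]mulr_natr.
  have -> : (W%:R ^+ 2 * q) * 'C(n, #|A|)%:R^-1 = F A * W%:R.
    by rewrite /F; ring.
  rewrite ler_wpM2l // ler_nat; apply: leq_trans (_ : bin_sum n s <= W)%N.
    have := card_small_sets 'I_n s; rewrite card_ord; apply: leq_trans.
    by apply: subset_leq_card; apply/subsetP => S; rewrite inE.
  by rewrite /W /bin_sum [leqRHS]big_ord_recr leq_addr.
by rewrite -mulr_sumr sum_inv_bin mulrC mulrA.
Qed.

(** * Exponential estimates *)

Lemma bernoulli_ineq (R : realFieldType) (x : R) n : -1 <= x ->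
  1 + n%:R * x <= (1 + x) ^+ n.
Proof.
move=> x1; elim: n => [|n IH]; first by rewrite expr0 mul0r addr0.
have x0 : 0 <= 1 + x by lra.
rewrite exprS; apply: le_trans (ler_wpM2l x0 IH).
have : 0 <= n%:R * x ^+ 2 :> R by rewrite mulr_ge0 ?sqr_ge0.
rewrite -natr1; lra.
Qed.

(** The factor M^s left over by [bin_sum_bound] is at most (1 + 1/M)^n, since (1 + 1/M)^(M^2) >= 1 +
    M by Bernoulli and M^2 s <= n. *)
Lemma bin_sum_le (R : realFieldType) M n s : (0 < M)%N -> (M ^ 2 * s <= n)%N ->
  (bin_sum n s)%:R <= (1 + M%:R^-1) ^+ (2 * n) :> R.
Proof.
move=> M0 Ms; have M0R : 0 < M%:R :> R by rewrite ltr0n.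
have sn : (s <= n)%N by apply: leq_trans Ms; rewrite leq_pmull // expn_gt0 M0.
have y1 : 1 <= 1 + M%:R^-1 :> R by rewrite lerDl invr_ge0.
have y0 : 0 <= 1 + M%:R^-1 :> R by apply: le_trans y1.
have B : (bin_sum n s)%:R <= (1 + M%:R^-1) ^+ n * M%:R ^+ s :> R.
  have := bin_sum_bound M0 sn; rewrite -(ler_nat R) natrM !natrX.
  have -> : M.+1%:R = M%:R * (1 + M%:R^-1) :> R.
    by rewrite mulrDr mulr1 divff ?natr1 // lt0r_neq0.
  move=> h; rewrite -(ler_pM2r (exprn_gt0 (n - s)%N M0R)) -mulrA -exprD.
  rewrite subnKC //.
  by apply: le_trans h _; rewrite exprMn mulrC.
apply: le_trans B _; rewrite mul2n -addnn exprD ler_wpM2l ?exprn_ge0 //.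
apply: (@le_trans _ _ (((1 + M%:R^-1) ^+ (M ^ 2)) ^+ s)).
  apply: lerXn2r; rewrite ?nnegrE ?exprn_ge0 //.
  apply: (@le_trans _ _ (1 + (M ^ 2)%N%:R * M%:R^-1)).
    by rewrite natrX expr2 mulfK ?lt0r_neq0 // lerDr.
  by apply: bernoulli_ineq; apply: (@le_trans _ _ 0); rewrite ?lerN10 ?invr_ge0.
by rewrite -exprM; apply: ler_weXn2l.
Qed.

(* The square of the bound of bin_sum_le has exponent 4n, against (7/8) ^ (n/8)
   in separable_prob: the rate must satisfy y ^ 32 < 8/7. *)
Lemma ex_growth_rate (R : realFieldType) :
  exists2 M : nat, (8 <= M)%N & (1 + M%:R^-1) ^+ 32 <= 16 / 15 :> R.
Proof.
exists 511%N => //; have := @bernoulli_ineq R (- 512^-1) 32.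
have -> : 1 + 511%:R^-1 = (1 - 512^-1)^-1 :> R by field.
have p : 0 < (1 - 512^-1) ^+ 32 :> R by rewrite exprn_gt0 //; lra.
move=> /(_ ltac:(lra)) h; rewrite exprVn -[leRHS]invrK lef_pV2 ?posrE //;
  last first.
  by rewrite invr_gt0; lra.
by apply: le_trans h; lra.
Qed.

Lemma separable_prob_le (R : realType) (M : nat) : (8 <= M)%N ->
  (1 + M%:R^-1) ^+ 32 <= 16 / 15 :> R ->
  exists C : R, forall d n : nat, (2 < d)%N -> ~~ odd (d * n) ->
    (M ^ 2 * 2 <= n)%N ->
    config_prob R d (fun G : sgraph 'I_n => separable G (n %/ M ^ 2).-1) <=
      C * n.+1%:R^-1.
Proof.
(* The constant is 2 * 240^2, where 240 = 8 * 30 is the bound on w(n + 1) obtained below. *)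
move=> M8 yM; exists (2 * 900 * 8 * 8) => d n d3 evn Mn.
have M20 : (0 < M ^ 2)%N by rewrite expn_gt0; lia.
have n64 : (64 <= n)%N by apply: leq_trans Mn; nia.
(* The predecessor leaves room for the [s.+1] in [separable_prob]. *)
set s := (n %/ M ^ 2).-1; set m := (n %/ 8).-1.
have s1 : (M ^ 2 * s.+1 <= n)%N.
  rewrite prednK ?divn_gt0 //; last by lia.
  by rewrite mulnC leq_divM.
have M0 : (0 < M)%N by lia.
have n0 : (0 < n)%N by lia.
apply: le_trans (separable_prob R s d3 evn n0) _; rewrite -/m.
set y := 1 + M%:R^-1 : R in yM *.
have y1 : 1 <= y by rewrite lerDl invr_ge0.
have y0 : 0 <= y by apply: le_trans y1.
have W : (bin_sum n s.+1)%:R ^+ 2 <= (16 / 15 : R) ^+ m.+2.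
  apply: (@le_trans _ _ ((y ^+ (2 * n)) ^+ 2)).
    by apply: lerXn2r; rewrite ?nnegrE ?exprn_ge0 //; apply: bin_sum_le.
  rewrite -exprM; apply: (@le_trans _ _ ((y ^+ 32) ^+ m.+2)).
    by rewrite -exprM; apply: ler_weXn2l => //; rewrite /m; lia.
  by apply: lerXn2r; rewrite ?nnegrE ?exprn_ge0 //; lra.
have q0 : 0 <= (7 / 8 : R) ^+ m by rewrite exprn_ge0 //; lra.
(* Here (16/15)(7/8) = 14/15 <= (30/31)^2 and (16/15)^2 <= 2; the square lets each of two factors n
   + 1 be absorbed by one power of (30/31)^m. *)
have {W} : (bin_sum n s.+1)%:R ^+ 2 * (7 / 8) ^+ m <=
    2 * ((30 / 31) ^+ m) ^+ 2 :> R.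
  apply: le_trans (ler_wpM2r q0 W) _.
  have -> : (16 / 15 : R) ^+ m.+2 * (7 / 8) ^+ m =
      (16 / 15) ^+ 2 * (14 / 15) ^+ m.
    rewrite -[m.+2]addn2 exprD mulrAC -exprMn mulrC; congr (_ * _ ^+ _);
      by field.
  apply: ler_pM; rewrite ?exprn_ge0 //; try lra.
  by rewrite exprAC; apply: lerXn2r; rewrite ?nnegrE ?exprn_ge0 //; lra.
set w := (30 / 31) ^+ m.
have w0 : 0 <= w by rewrite exprn_ge0 //; lra.
have m0 : 0 <= m%:R :> R by [].
have wm : w * (m%:R + 30) <= 30.
  have := @bernoulli_ineq R (1 / 30) m ltac:(lra).
  have -> : 1 + 1 / 30 = (30 / 31)^-1 :> R by field.
  rewrite exprVn -/w => h.
  have wp : 0 < w by rewrite exprn_gt0 //; lra.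
  have := ler_wpM2l w0 h; rewrite divff ?lt0r_neq0 //; lra.
have nm : n.+1%:R <= 8 * (m%:R + 30) :> R.
  by rewrite -natrD -natrM ler_nat /m; lia.
rewrite ler_pdivlMr ?ltr0n // -mulrA => h.
have n1 : 0 <= n.+1%:R :> R by [].
have := ler_wpM2l n1 h.
set b := _ * (7 / 8) ^+ m => {}h.
apply: (@le_trans _ _ (n.+1%:R * (2 * w ^+ 2) * n.+1%:R)).
  by rewrite ler_wpM2r.
have : (w * n.+1%:R) ^+ 2 <= (240 : R) ^+ 2.
  apply: lerXn2r; rewrite ?nnegrE ?mulr_ge0 //.
  have := ler_wpM2l w0 nm; lra.
rewrite exprMn; lra.
Qed.

(** * Convergence of the probability *)

Lemma config_prob_le1 (R : realType) n d (E : sgraph 'I_n -> Prop) :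
  config_prob R d E <= 1.
Proof.
rewrite /config_prob; set PM := perfect_matchings _.
have [->|PM0] := posnP #|PM|; first by rewrite invr0 mulr0.
rewrite ler_pdivrMr ?ltr0n // mul1r ler_nat; apply: subset_leq_card.
by apply/subsetP => M; rewrite inE => /andP[].
Qed.

(** As dn is even, a matching exists; with none, both probabilities would be 0 by convention. *)
Lemma config_prob_cover (R : realType) n d (E S : sgraph 'I_n -> Prop) :
  ~~ odd (d * n) -> (forall G, ~ E G -> S G) ->
  1 <= config_prob R d E + config_prob R d S.
Proof.
move=> evn ES; rewrite /config_prob; set PM := perfect_matchings _.
have PM0 : (0 < #|PM|)%N.
  rewrite (@card_matchings _ [set: _]) cardsT card_prod !card_ord.
  by rewrite num_matchings_gt0 // mulnC.
rewrite -mulrDl ler_pdivlMr ?ltr0n // mul1r -natrD ler_nat.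
apply: leq_trans (leq_card_setU _ _); apply: subset_leq_card.
apply/subsetP => M MP; apply/setUP.
case: (asboolP (E (config_graph M))) => [EM|nE]; [left | right];
  rewrite in_set; apply/andP; split=> //; apply/asboolP => //; exact: ES.
Qed.

From mathcomp Require Import all_classical all_reals all_analysis.

Import numFieldNormedType.Exports.
Local Open Scope classical_set_scope.

Theorem corollary4p6 (R : realType) (d : nat) (hd : (3 <= d)%N) :
  exists eta : R, 0 < eta /\
    config_prob R d (fun G : sgraph 'I_n =>
        eta * n%:R <= (treewidth G)%:R /\ eta * n%:R <= (treedepth G)%:R)
      @[n --> within [set n : nat | ~~ odd (d * n)%N] \oo] --> (1 : R).
Proof.
have [M M8 yM] := ex_growth_rate R; have [C hC] := separable_prob_le M8 yM.
have M20 : (0 < M ^ 2)%N by rewrite expn_gt0; lia.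
pose eta : R := (2 * M ^ 2)%N%:R^-1.
have M2 : 0 < (2 * M ^ 2)%N%:R :> R by rewrite ltr0n; lia.
have eta0 : 0 < eta by rewrite invr_gt0.
exists eta; split=> //.
have low n k : ~ (eta * n%:R <= k%:R) -> (2 * M ^ 2 * k < n)%N.
  move/negP; rewrite -ltNge /eta -(ltr_pM2l M2) mulVKf ?lt0r_neq0 //.
  by rewrite -natrM ltr_nat.
(* The factor 2 in [eta] ensures (k + 2) M^2 <= n: this follows from 4 M^2 <= n if k <= 2, and from
   k + 2 <= 2k otherwise. *)
have small n k : (4 * M ^ 2 <= n -> 2 * M ^ 2 * k < n -> k.+1 < n %/ M ^ 2)%N.
  by rewrite leq_divRL //; move: (M ^ 2)%N => K; lia.
have close : forall n : nat, ~~ odd (d * n) -> (4 * M ^ 2 <= n)%N ->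
    `|1 - config_prob R d (fun G : sgraph 'I_n =>
        eta * n%:R <= (treewidth G)%:R /\ eta * n%:R <= (treedepth G)%:R)|
      <= C * n.+1%:R^-1.
  move=> n evn Mn; rewrite ger0_norm ?subr_ge0 ?config_prob_le1 //.
  have Mn2 : (M ^ 2 * 2 <= n)%N by lia.
  apply: le_trans (hC d n hd evn Mn2); rewrite lerBlDl.
  apply: config_prob_cover => // G nE.
  (* As M >= 8, also M^2 >= 8, so separators of this size have at most n/8 vertices. *)
  have k8 : (8 * (n %/ M ^ 2).-1 <= #|'I_n|)%N.
    rewrite card_ord; apply: leq_trans (leq_divM n (M ^ 2)); rewrite mulnC.
    by apply: leq_mul; [exact: leq_pred | nia].
  have [ltw|ltd] : (2 * M ^ 2 * treewidth G < n \/
      2 * M ^ 2 * treedepth G < n)%N.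
    case: (lerP (eta * n%:R) (treewidth G)%:R) => htw; last first.
      by left; apply: low; apply/negP; rewrite -ltNge.
    by right; apply: low => htd; apply: nE.
  - by apply: treewidth_separable k8; rewrite ltn_predRL small.
  - by apply: treedepth_separable k8; rewrite ltnW // ltn_predRL small.
apply/cvgrPdist_le => e e0; rewrite near_withinE /=.
have : (C * harmonic n : R) @[n --> \oo] --> C * 0 by apply: cvgMr;
  exact: cvg_harmonic.
rewrite mulr0 => /cvgrPdist_le/(_ e e0) hh.
near=> n => evn; apply: le_trans (close n evn _) _; first by near: n;
  exact: nbhs_infty_ge.
have : `|0 - C * harmonic n| <= e by near: n.
by rewrite sub0r normrN /harmonic /=; apply: le_trans; exact: ler_norm.
Unshelve. all: by end_near.
Qed.
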